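(* Let $\kappa>0$ be any absolute constant and let $t(n)$ (a positive integer) and $\rho(n)=1-\delta(n)$ be such that $t(n)\rho(n)\le 1/n^{\kappa}$. Then for sufficiently large $n$, $L_{t(n),\mathrm{worst}}(\delta(n),n)\le (2/3+o_n(1))\,n$, where $o_n(1)$ denotes a quantity tending to $0$ as $n\to\infty$.
   Context: For $x\in\{0,1\}^n$ and $0<\delta<1$, the deletion channel $\mathrm{Del}_\delta(x)$ is the distribution over $\{0,1\}^{\le n}$ obtained by independently deleting each bit of $x$ with probability $\delta$ and concatenating the surviving bits; a draw from it is a trace of $x$. $|\mathsf{LCS}(u,v)|$ denotes the length of a longest common subsequence of strings $u,v$. A $t$-trace algorithm $A$ receives $n,\delta$ and $t$ independent traces $y^{(1)},\dots,y^{(t)}\sim\mathrm{Del}_\delta(x)$ and outputs an $n$-bit string. Define $L_{t,\mathrm{worst}}(\delta,n):=\max_A\min_{x\in\{0,1\}^n}\mathbb{E}_{y^{(1)},\dots,y^{(t)}\sim\mathrm{Del}_\delta(x)}[|\mathsf{LCS}(A(y^{(1)},\dots,y^{(t)},n),x)|]$, the maximum over all such algorithms. *)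

(* Defs.v *)
From mathcomp Require Import all_boot all_order all_algebra.
From mathcomp Require Import all_classical all_reals all_analysis.

Set Implicit Arguments.
Unset Strict Implicit.
Unset Printing Implicit Defensive.

Import Order.TTheory GRing.Theory Num.Theory.

Local Open Scope ring_scope.

Definition lcs (u v : seq bool) : nat :=
  \max_(w : (size u).-bseq bool | subseq w u && subseq w v) size w.

(* Probability mass function of Del_delta(x) on {0,1}^{<= n}. The bit m_i of the
   mask m tells whether x_i survives; distinct masks may yield the same trace. *)
Definition Del (R : realType) (n : nat) (delta : R) (x : n.-tuple bool)
    (y : n.-bseq bool) : R :=
  \sum_(m : n.-tuple bool | mask m x == y :> seq bool)
    \prod_(i < n) (if tnth m i then 1 - delta else delta).

(* For fixed n and delta, a t-trace algorithm is a map from t-tuples of traces to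
   n-bit strings. *)
Definition algorithm (t n : nat) :=
  {ffun t.-tuple (n.-bseq bool) -> n.-tuple bool}.

Definition expected_lcs (R : realType) (t : nat) (delta : R) (n : nat)
    (A : algorithm t n) (x : n.-tuple bool) : R :=
  \sum_(ys : t.-tuple (n.-bseq bool))
    (\prod_(i < t) Del delta x (tnth ys i)) * (lcs (A ys) x)%:R.

(* Both index types are finite and inhabited, and the expectation lies in [0, n]
   when 0 <= delta <= 1, so the default values 0 and n do not affect the
   maximum and the minimum. *)
Definition Lworst (R : realType) (t : nat) (delta : R) (n : nat) : R :=
  \big[Num.max/0]_(A : algorithm t n)
    \big[Num.min/n%:R]_(x : n.-tuple bool) expected_lcs delta A x.

(* Main.v *)
Require Import Defs.
From mathcomp Require Import all_boot all_order all_algebra.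
From mathcomp Require Import all_classical all_reals all_analysis.
From mathcomp Require Import zify ring lra.
Import Order.TTheory GRing.Theory Num.Theory.
Import numFieldNormedType.Exports.

Set Implicit Arguments.
Unset Strict Implicit.
Unset Printing Implicit Defensive.

(** The hard input is a concatenation of blocks of constant length, each of them
    a square wave 0^m 1^m 0^m 1^m ... whose half-period m = M^(k+1) has a scale
    k drawn independently and uniformly from a large constant number of scales.

    A string u has a small common subsequence with most waves: an energy
    increment argument shows that for all but M^2 scales the density of zeros
    of u hardly changes between the scales k and k + 2.  Matching a stretch of
    u with density p of zeros against runs of zeros and ones then yields at most
    min(p a, m) + min((1 - p) b, m) <= (a + b + 2 m) / 3 symbols, that is, a
    third of the total length used in u and in the wave.  Cutting an arbitrary z
    of length n along an alignment and bounding the number of alignments, on a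
    coarse grid, against the exponentially small probability that many blocks
    draw a bad scale, LCS(z, x) <= (2/3 + O(1/M)) n except for an exponentially
    small fraction of the inputs x.

    The t traces depend on at most t rho n = o(n) positions of x on average, so
    for fixed deletion masks the algorithm has only 2^o(n) possible outputs, and
    a union bound over them concludes. *)

(** * Common subsequences *)

Lemma lcs_leP (u v : seq bool) (c : nat) :
  reflect (forall w, subseq w u -> subseq w v -> size w <= c) (lcs u v <= c).
Proof.
apply: (iffP (bigmax_leqP _ _ _)) => [H w wu wv|H w /andP[wu wv]]; last exact: H.
by have := H (Bseq (size_subseq wu)); apply; rewrite /= wu.
Qed.

Lemma lcs_witness (u v : seq bool) :
  exists w, [/\ subseq w u, subseq w v & size w = lcs u v].
Proof.
apply: contrapT => H.
case E: (lcs u v) => [|c].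
  by apply: H; exists [::]; rewrite !sub0seq E.
suff : lcs u v <= c by rewrite E ltnn.
apply/lcs_leP => w wu wv; rewrite leqNgt; apply/negP => cw; apply: H; exists w.
by split=> //; apply/eqP; rewrite eqn_leq E cw andbT -E; exact/lcs_leP.
Qed.

Lemma lcsC (u v : seq bool) : lcs u v = lcs v u.
Proof.
by apply/eqP; rewrite eqn_leq; apply/andP; split; apply/lcs_leP => w wu wv;
  exact/lcs_leP.
Qed.

Lemma lcs_sizel (u v : seq bool) : lcs u v <= size u.
Proof. by apply/lcs_leP => w /size_subseq. Qed.

Lemma lcs_sizer (u v : seq bool) : lcs u v <= size v.
Proof. by rewrite lcsC lcs_sizel. Qed.

Lemma lcs_subseql (u u' v : seq bool) : subseq u u' -> lcs u v <= lcs u' v.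
Proof.
by move=> uu'; apply/lcs_leP => w wu wv; apply/(lcs_leP u' v) => //;
  exact: subseq_trans uu'.
Qed.

Lemma subseq_catP (T : eqType) (w u v : seq T) : subseq w (u ++ v) ->
  exists p, subseq (take p w) u /\ subseq (drop p w) v.
Proof.
elim: u w => [|a u IH] [|b w] //=.
- by move=> _; exists 0; rewrite ?sub0seq.
- by move=> H; exists 0; rewrite ?sub0seq.
- by move=> _; exists 0; rewrite ?sub0seq.
- case: eqVneq => [<-|ba] /IH [p [wu wv]].
    by exists p.+1; rewrite /= eqxx.
  case: p wu wv => [|p] /= wu wv; first by exists 0.
  by exists p.+1; rewrite /= (negbTE ba).
Qed.

Lemma cat_subseqP (T : eqType) (w1 w2 z : seq T) : subseq (w1 ++ w2) z ->
  exists2 p, p <= size z & subseq w1 (take p z) /\ subseq w2 (drop p z).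
Proof.
elim: z w1 => [|a z IH] [|b w1] /= H.
- by exists 0.
- by [].
- by exists 0; rewrite ?sub0seq.
move: H; case: eqVneq => [<-|ba].
  by move=> /IH [p pz [h1 h2]]; exists p.+1; rewrite //= eqxx.
rewrite -cat_cons => /IH [p pz [h1 h2]]; exists p.+1; rewrite //=.
by rewrite (negbTE ba).
Qed.

Lemma lcs_catr (z u v : seq bool) : exists2 p, p <= size z &
  lcs z (u ++ v) <= lcs (take p z) u + lcs (drop p z) v.
Proof.
have [w [wz wuv <-]] := lcs_witness z (u ++ v).
have [q [qu qv]] := subseq_catP wuv.
rewrite -(cat_take_drop q w) in wz *.
have [p pz [pu pv]] := cat_subseqP wz; exists p => //.
by rewrite size_cat leq_add //; apply/lcs_leP.
Qed.

Lemma lcs_cat_sizer (z u v : seq bool) :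
  lcs z (u ++ v) <= lcs z u + size v.
Proof.
have [p _ /leq_trans->//] := lcs_catr z u v.
by rewrite leq_add ?lcs_sizer// lcs_subseql// take_subseq.
Qed.

Lemma lcs_nseq (u : seq bool) (m : nat) (b : bool) :
  lcs u (nseq m b) <= minn (count_mem b u) m.
Proof.
have := lcs_sizer u (nseq m b); rewrite size_nseq leq_min => ->; rewrite andbT.
apply/lcs_leP => w wu wb.
have : all (pred1 b) w.
  apply/allP => x /(mem_subseq wb); rewrite mem_nseq => /andP[_ /eqP->].
  exact: eqxx.
by rewrite all_count => /eqP <-; exact: leq_count_subseq.
Qed.

Definition slice (T : Type) (x y : nat) (z : seq T) := take (y - x) (drop x z).

Lemma size_slice (T : Type) (x y : nat) (z : seq T) : y <= size z ->
  size (slice x y z) = y - x.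
Proof. by move=> yz; rewrite /slice size_takel// size_drop leq_sub2r. Qed.

Lemma take_slice (T : Type) (x y p : nat) (z : seq T) : x <= y ->
  p <= y - x -> take p (slice x y z) = slice x (x + p) z.
Proof. by move=> xy pxy; rewrite /slice take_takel// addKn. Qed.

Lemma drop_slice (T : Type) (x y p : nat) (z : seq T) : x <= y ->
  p <= y - x -> drop p (slice x y z) = slice (x + p) y z.
Proof.
move=> xy pxy; rewrite /slice !take_drop drop_drop (addnC p).
by rewrite !subnK// -leq_subRL.
Qed.

Lemma slice_subseq (x y x' y' : nat) (z : seq bool) :
  x' <= x -> y <= y' -> subseq (slice x y z) (slice x' y' z).
Proof.
move=> xx yy; rewrite /slice.
have [xy|yx] := leqP x y; last first.
  have -> : y - x = 0 by lia.
  by rewrite take0 sub0seq.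
rewrite !take_drop !subnK//; last by lia.
rewrite -{1}(subnK xx) -drop_drop; apply: subseq_trans (drop_subseq _ _) _.
have xy' := leq_trans xx xy; have yy' := leq_trans xy' yy.
rewrite -(subnK xy') -(subnK yy') -!take_drop.
by rewrite -(take_takel _ (leq_sub2r x' yy)); exact: take_subseq.
Qed.

Lemma lcs_slice_catr (z u v : seq bool) (x y : nat) : x <= y -> y <= size z ->
  exists2 p, x <= p <= y &
  lcs (slice x y z) (u ++ v) <= lcs (slice x p z) u + lcs (slice p y z) v.
Proof.
move=> xy yz; have [p] := lcs_catr (slice x y z) u v.
rewrite size_slice// => pxy H; exists (x + p); first by lia.
by rewrite take_slice// drop_slice// in H.
Qed.

Local Open Scope ring_scope.

(** Cutting the slice along an alignment with the copies of [P] makes the differences of the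
    potential [h] telescope, while each copy costs [c]. *)
Lemma lcs_slice_nseq (R : realType) (z P : seq bool) (h : nat -> R) (c : R) :
  (forall x y, (x <= y <= size z)%N ->
    (lcs (slice x y z) P)%:R <= h y - h x + c) ->
  forall r x y, (x <= y <= size z)%N -> h x <= h y ->
    (lcs (slice x y z) (flatten (nseq r P)))%:R <= h y - h x + c *+ r.
Proof.
(* The case [r = 0] is where [h x <= h y] enters; splitting it off spares the induction any
   comparison of [h] at the cut points. *)
move=> H; suff K r x y : (x <= y <= size z)%N -> (0 < r)%N ->
    (lcs (slice x y z) (flatten (nseq r P)))%:R <= h y - h x + c *+ r.
  move=> [|r] x y xyz hxy; last exact: K.
  rewrite /= addr0; apply: le_trans (_ : 0%:R <= _); last by rewrite subr_ge0.
  by rewrite ler_nat; exact: lcs_sizer.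
move=> + r0; elim: r r0 x y => // -[_ _|r IH _] x y xyz.
  by rewrite /= cats0; exact: H.
have /andP[xy yz] := xyz.
have [p /andP[xp py] L] := lcs_slice_catr P (flatten (nseq r.+1 P)) xy yz.
have h1 := H x p _; have h2 := IH isT p y _.
rewrite mulrS.
have {L} : (lcs (slice x y z) (flatten (nseq r.+2 P)))%:R <=
  (lcs (slice x p z) P)%:R + (lcs (slice p y z) (flatten (nseq r.+1 P)))%:R :> R.
  by rewrite -natrD ler_nat.
have := h1 ltac:(lia); have := h2 ltac:(lia).
lra.
Qed.

(** * Square waves and the energy increment *)

(* The weights of this convex combination of [p a] and [m] make the
   coefficient of [a] equal to 1/3. *)
Lemma ler_min_tangent (R : realType) (p a m : R) : 1 / 3 <= p -> 0 <= a ->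
  0 <= m -> Num.min (p * a) m <= a / 3 + (1 - (3 * p)^-1) * m.
Proof.
move=> p3 a0 m0.
have p0 : 0 < p by lra.
have q0 : 0 <= (3 * p)^-1 by rewrite invr_ge0; lra.
have q1 : (3 * p)^-1 <= 1 by rewrite invf_le1; lra.
have pq : (3 * p)^-1 * (p * a) = a / 3 by field; rewrite gt_eqF.
rewrite -pq.
have h1 : Num.min (p * a) m <= p * a by rewrite ge_min lexx.
have h2 : Num.min (p * a) m <= m by rewrite ge_min lexx orbT.
nra.
Qed.

(** If [p] or [1 - p] is at most 1/3, one minimum is bounded by its linear term and the other by
    weights 1/3 and 2/3. Otherwise the two tangent bounds add up, and [p * (1 - p) <= 1 / 4] leaves
    [m] a coefficient of at most 2/3. *)
Lemma ler_min_two_thirds (R : realType) (p a b m : R) : 0 <= p <= 1 ->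
  0 <= a -> 0 <= b -> 0 <= m ->
  Num.min (p * a) m + Num.min ((1 - p) * b) m <= (a + b + 2 * m) / 3.
Proof.
move=> /andP[p0 p1] a0 b0 m0.
have h1 : Num.min (p * a) m <= p * a by rewrite ge_min lexx.
have h2 : Num.min (p * a) m <= m by rewrite ge_min lexx orbT.
have h3 : Num.min ((1 - p) * b) m <= (1 - p) * b by rewrite ge_min lexx.
have h4 : Num.min ((1 - p) * b) m <= m by rewrite ge_min lexx orbT.
have [p3|p3] := leP p (1 / 3); first by nra.
have [q3|q3] := leP (1 - p) (1 / 3); first by nra.
have := ler_min_tangent (ltW p3) a0 m0.
have := ler_min_tangent (ltW q3) b0 m0.
have : (3 * p)^-1 + (3 * (1 - p))^-1 >= 4 / 3.
  have -> : (3 * p)^-1 + (3 * (1 - p))^-1 = (3 * (p * (1 - p)))^-1.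
    by field; rewrite !gt_eqF//; lra.
  have pq0 : 0 < 3 * (p * (1 - p)) by rewrite !mulr_gt0//; lra.
  rewrite -[leRHS]mul1r ler_pdivlMr//.
  have : 0 <= (2 * p - 1) ^+ 2 by exact: sqr_ge0.
  nra.
nra.
Qed.

Section Density.
Variable R : realType.
Variable u : seq bool.

Definition zeros (x : nat) : R := (count_mem false (take x u))%:R.

Lemma zeros_diff x y : (x <= y)%N ->
  zeros y - zeros x = (count_mem false (slice x y u))%:R.
Proof.
move=> xy; rewrite /zeros.
rewrite -{1}(subnKC xy) takeD count_cat natrD addrAC subrr add0r.
by [].
Qed.

Lemma zeros_diff_bounds x y : (x <= y)%N ->
  0 <= zeros y - zeros x <= (y - x)%:R.
Proof.
move=> xy; rewrite zeros_diff// ler0n ler_nat /=.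
by rewrite (leq_trans (count_size _ _))// /slice size_take_min geq_minl.
Qed.

Lemma count_true_slice x y : (x <= y <= size u)%N ->
  (count_mem true (slice x y u))%:R = (y - x)%:R - (zeros y - zeros x) :> R.
Proof.
move=> /andP[xy yu]; rewrite zeros_diff// -(size_slice _ yu).
rewrite -(count_predC (pred1 false) (slice x y u)) natrD addrC addKr.
by congr (_%:R); apply: eq_count => -[].
Qed.

Definition bzeros (s j : nat) : R := zeros (j.+1 * s) - zeros (j * s).

(** Each term is [s] times the squared density of zeros in a block, so the energies of one stretch
    of [u] at different scales are comparable. *)
Definition energy (s n : nat) : R := \sum_(j < n) bzeros s j ^+ 2 / s%:R.

(* Cumulated discrepancy between the density of zeros in the blocks of length
   [s] and that in the blocks of length [s * q] containing them. *)
Definition discrep (s q x : nat) : R :=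
  \sum_(j < x %/ s)
    `|bzeros s j - s%:R * (bzeros (s * q) (j %/ q) / (s * q)%:R)|.

Lemma bzeros_bounds s j : 0 <= bzeros s j <= s%:R.
Proof.
have := @zeros_diff_bounds (j * s) (j.+1 * s); rewrite leq_mul2r leqnSn orbT.
by move=> /(_ isT); rewrite mulSn addnK.
Qed.

Lemma bzeros_mul s q j :
  bzeros (s * q) j = \sum_(i < q) bzeros s (j * q + i).
Proof.
rewrite /bzeros; elim: q j => [|q IH] j.
  by rewrite big_ord0 !muln0 subrr.
suff K k : (k <= q.+1)%N -> zeros ((j * q.+1 + k) * s) - zeros (j * q.+1 * s)
    = \sum_(i < k) bzeros s (j * q.+1 + i).
  rewrite -K// /bzeros; congr (zeros _ - zeros _); ring.
elim: k => [_|k IHk kq]; first by rewrite big_ord0 addn0 subrr.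
rewrite big_ord_recr /= -IHk 1?ltnW// /bzeros addnS.
ring.
Qed.

Lemma discrep_ge0 s q x : 0 <= discrep s q x.
Proof. exact: sumr_ge0. Qed.

Lemma discrep_diff s q x y : (x <= y)%N ->
  discrep s q y - discrep s q x = \sum_((x %/ s)%N <= j < (y %/ s)%N)
    `|bzeros s j - s%:R * (bzeros (s * q) (j %/ q) / (s * q)%:R)|.
Proof.
move=> xy; rewrite /discrep -!(big_mkord xpredT (fun j : nat =>
  `|bzeros s j - s%:R * (bzeros (s * q) (j %/ q) / (s * q)%:R)|)).
by rewrite (big_cat_nat (leq0n (x %/ s)) (leq_div2r s xy))/= addrAC subrr add0r.
Qed.

Lemma discrep_le s q x y : (x <= y)%N -> discrep s q x <= discrep s q y.
Proof.
by move=> xy; rewrite -subr_ge0 discrep_diff// sumr_ge0.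
Qed.

(** Rounding [x] and [y] down to multiples of [s] leaves whole fine blocks, whose deviations from
    the coarse density [p] are summed by [discrep], and two remainders worth at most [s] each. *)
Lemma zeros_discrep s q x y p : (0 < s)%N -> (0 < q)%N -> (x <= y)%N ->
  (x %/ (s * q) = y %/ (s * q))%N ->
  p = bzeros (s * q) (x %/ (s * q)) / (s * q)%:R ->
  `|zeros y - zeros x - p * (y - x)%:R|
    <= discrep s q y - discrep s q x + 2 * s%:R.
Proof.
move=> s0 q0 xy xyE pE; rewrite discrep_diff//.
set a := (x %/ s)%N; set b := (y %/ s)%N.
have ab : (a <= b)%N by exact: leq_div2r.
have sR : 0 < s%:R :> R by rewrite ltr0n.
have sqR : 0 < (s * q)%:R :> R by rewrite ltr0n muln_gt0 s0.
have /andP[p0 p1] : 0 <= p <= 1.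
  have /andP[h1 h2] := bzeros_bounds (s * q) (x %/ (s * q)).
  rewrite pE; apply/andP; split; first exact: divr_ge0.
  by rewrite ler_pdivrMr// mul1r.
have rem z : `|zeros z - zeros (z %/ s * s) - p * (z - z %/ s * s)%:R| <= s%:R.
  have le : (z %/ s * s <= z)%N by exact: leq_divM.
  have lt : (z - z %/ s * s <= s)%N.
    by rewrite leq_subLR addnC -mulSn ltnW// ltn_ceil.
  have /andP[h1 h2] := zeros_diff_bounds le.
  have h3 : (z - z %/ s * s)%:R <= s%:R :> R by rewrite ler_nat.
  have h4 : 0 <= (z - z %/ s * s)%:R :> R by [].
  rewrite ler_norml; nra.
have -> : zeros y - zeros x - p * (y - x)%:R =
   \sum_(a <= j < b) (bzeros s j - s%:R * p)
   + (zeros y - zeros (b * s) - p * (y - b * s)%:R)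
   - (zeros x - zeros (a * s) - p * (x - a * s)%:R).
  have -> : \sum_(a <= j < b) (bzeros s j - s%:R * p) =
     zeros (b * s) - zeros (a * s) - (b - a)%:R * (s%:R * p).
    rewrite sumrB (telescope_sumr (fun j => zeros (j * s)))//.
    by rewrite sumr_const_nat !mulr_natl.
  rewrite !natrB ?leq_divM// !natrM; ring.
have := rem y; have := rem x; rewrite -/a -/b => hx hy.
apply: le_trans (ler_normB _ _) _.
apply: le_trans (lerD (ler_normD _ _) (lexx _)) _.
have : `|\sum_(a <= j < b) (bzeros s j - s%:R * p)| <=
  \sum_(a <= j < b)
    `|bzeros s j - s%:R * (bzeros (s * q) (j %/ q) / (s * q)%:R)|.
  apply: le_trans (ler_norm_sum _ _ _) _.
  rewrite !big_nat; apply: ler_sum => j /andP[aj jb].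
  suff -> : (j %/ q = x %/ (s * q))%N by rewrite -pE.
  apply/eqP; rewrite eqn_leq {1}xyE !divnMA !leq_div2r//.
  exact: ltnW.
lra.
Qed.

End Density.

Lemma sum_ord_mul (V : nmodType) (J q : nat) (f : nat -> V) :
  \sum_(j < J * q) f j = \sum_(a < J) \sum_(i < q) f (a * q + i)%N.
Proof.
elim: J => [|J IH]; first by rewrite mul0n !big_ord0.
rewrite big_ord_recr /= -IH mulSnr.
rewrite -!(big_mkord xpredT f) (big_cat_nat _ (leq_addr _ _))//=.
rewrite -{2}(add0n (J * q)%N) big_addn addKn big_mkord; congr (_ + _).
by rewrite big_mkord; apply: eq_bigr => i _; rewrite addnC.
Qed.

Lemma sum_ord_const (R : pzRingType) (n : nat) (x : R) :
  \sum_(i < n) x = n%:R * x.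
Proof. by rewrite sumr_const card_ord mulr_natl. Qed.

Section Energy.
Variable R : realType.
Variable u : seq bool.

Lemma energy_ge0 s n : 0 <= energy R u s n.
Proof. by apply: sumr_ge0 => j _; rewrite divr_ge0// sqr_ge0. Qed.

Lemma energy_le s n : energy R u s n <= (n * s)%:R.
Proof.
rewrite natrM -sum_ord_const.
apply: ler_sum => j _; have /andP[b0 b1] := bzeros_bounds R u s j.
have [->|s0] := posnP s; first by rewrite invr0 mulr0.
by rewrite ler_pdivrMr ?ltr0n//; nra.
Qed.

(** Pythagoras: a coarse density is the mean of the [q] fine densities inside it, so the energy lost
    by coarsening is their variance. *)
Lemma energy_variance s q J : (0 < s)%N -> (0 < q)%N ->
  energy R u s (J * q) - energy R u (s * q) J = \sum_(j < J * q)
    (bzeros R u s j - s%:R * (bzeros R u (s * q) (j %/ q) / (s * q)%:R)) ^+ 2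
      / s%:R.
Proof.
move=> s0 q0; have sR : s%:R != 0 :> R by rewrite pnatr_eq0 -lt0n.
have qR : q%:R != 0 :> R by rewrite pnatr_eq0 -lt0n.
rewrite /energy (sum_ord_mul _ _ (fun j => bzeros R u s j ^+ 2 / s%:R)).
rewrite (sum_ord_mul _ _ (fun j => (bzeros R u s j -
  s%:R * (bzeros R u (s * q) (j %/ q) / (s * q)%:R)) ^+ 2 / s%:R)).
rewrite -sumrB; apply: eq_bigr => a _.
have E (i : 'I_q) : ((a * q + i) %/ q = a)%N.
  by rewrite divnMDl// divn_small// addn0.
under [RHS]eq_bigr => i _ do rewrite E.
set Bq := bzeros R u (s * q) a.
have BqE : Bq = \sum_(i < q) bzeros R u s (a * q + i) by exact: bzeros_mul.
transitivity (\sum_(i < q) bzeros R u s (a * q + i) ^+ 2 / s%:R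
  - (2 * Bq / (s * q)%:R) * Bq + q%:R * (Bq / (s * q)%:R * (Bq / q%:R))).
  by rewrite natrM; field; rewrite ?sR ?qR.
rewrite {2}BqE mulr_sumr -sumrB -(sum_ord_const q) -big_split /=.
by apply: eq_bigr => i _; rewrite natrM; field; rewrite ?sR ?qR.
Qed.

(** Linearised Cauchy-Schwarz: completing a square gives [y <= c / 4 * (y ^+ 2 / s) + s / c] for the
    deviation [y] of each block, with [c] left free. *)
Lemma discrep_energy s q J (c : R) : (0 < s)%N -> (0 < q)%N -> 0 < c ->
  discrep R u s q (J * (s * q)) <=
  c / 4 * (energy R u s (J * q) - energy R u (s * q) J) + (J * (s * q))%:R / c.
Proof.
move=> s0 q0 c0; rewrite energy_variance// /discrep.
have sR : 0 < s%:R :> R by rewrite ltr0n.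
have -> : (J * (s * q) = (J * q) * s)%N by ring.
rewrite mulnK// [((J * q) * s)%:R]natrM -[_ * s%:R / c]mulrA -(sum_ord_const (J * q)).
rewrite mulr_sumr -big_split /=.
apply: ler_sum => j _; set x := (X in `|X|).
rewrite -(real_normK (num_real x)); set y := `|x|.
have -> : c / 4 * (y ^+ 2 / s%:R) + s%:R / c =
    y + (c * y / 2 - s%:R) ^+ 2 / (c * s%:R).
  by field; rewrite !gt_eqF.
by rewrite lerDl divr_ge0 ?sqr_ge0// mulr_ge0// ltW.
Qed.

Definition period (m : nat) : seq bool := nseq m false ++ nseq m true.

(** Price of advancing to [z] in [u]: a third of the length, the error of treating the density as
    constant on coarse blocks, and a full period per coarse block passed. *)
Definition potential (s q m z : nat) : R :=
  z%:R / 3 + discrep R u s q z + 2 * m%:R * (z %/ (s * q))%:R.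

(* A period straddling a boundary of blocks of length [s * q] is paid for by the
   last term of [potential]. *)
Lemma lcs_period s q m x y : (0 < s)%N -> (0 < q)%N -> (x <= y <= size u)%N ->
  (lcs (slice x y u) (period m))%:R
     <= potential s q m y - potential s q m x + (2 * m%:R / 3 + 4 * s%:R) :> R.
Proof.
move=> s0 q0 /andP[xy yu].
have sR : 0 <= s%:R :> R by [].
have mR : 0 <= m%:R :> R by [].
have xyR : x%:R <= y%:R :> R by rewrite ler_nat.
have Fle := discrep_le R u s q xy.
case: (eqVneq (x %/ (s * q))%N (y %/ (s * q))%N) => [E|ne]; last first.
  have lt : (x %/ (s * q)).+1%:R <= (y %/ (s * q))%:R :> R.
    by rewrite ler_nat ltn_neqAle ne leq_div2r.
  have : (lcs (slice x y u) (period m))%:R <= 2 * m%:R :> R.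
    rewrite -natrM ler_nat (leq_trans (lcs_sizer _ _))//.
    by rewrite size_cat !size_nseq mul2n addnn.
  rewrite /potential -natr1 in lt *; nra.
have [v /andP[xv vy]] := lcs_slice_catr (nseq m false) (nseq m true) xy yu.
move=> H.
have {H} : (lcs (slice x y u) (period m))%:R <=
    Num.min (count_mem false (slice x v u))%:R m%:R
    + Num.min (count_mem true (slice v y u))%:R m%:R :> R.
  rewrite -!natr_min -natrD ler_nat (leq_trans H)//.
  by rewrite leq_add// minEnat; exact: lcs_nseq.
rewrite -zeros_diff// count_true_slice ?vy//.
have Ev : (x %/ (s * q) = v %/ (s * q))%N.
  by apply/eqP; rewrite eqn_leq leq_div2r//= E leq_div2r.
have Evy : (v %/ (s * q) = y %/ (s * q))%N by rewrite -Ev.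
set p := bzeros R u (s * q) (x %/ (s * q)) / (s * q)%:R.
have sqR : 0 < (s * q)%:R :> R by rewrite ltr0n muln_gt0 s0.
have p01 : 0 <= p <= 1.
  have /andP[h1 h2] := bzeros_bounds R u (s * q) (x %/ (s * q)).
  by rewrite /p divr_ge0//= ler_pdivrMr// mul1r.
have pv : p = bzeros R u (s * q) (v %/ (s * q)) / (s * q)%:R by rewrite -Ev.
have := zeros_discrep s0 q0 xv Ev (erefl p).
have := zeros_discrep s0 q0 vy Evy pv.
(* What is kept is an upper bound on the zeros before [v] and a lower bound on the zeros after it,
   hence an upper bound on the ones. Each costs a discrepancy and [2 * s]. *)
rewrite !ler_norml => /andP[H1 _] /andP[_ H2].
have := ler_min_two_thirds p01 (ler0n R (v - x)) (ler0n R (y - v)) mR.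
set A := (_ - zeros R u x); set A' := ((y - v)%:R - _).
have minD (a b e : R) : a <= b + e -> 0 <= e ->
    Num.min a m%:R <= Num.min b m%:R + e.
  move=> abe e0; rewrite ge_min; have [bm|bm] := leP b m%:R.
    by rewrite abe.
  by rewrite lerDl e0 orbT.
have Fxv := discrep_le R u s q xv; have Fvy := discrep_le R u s q vy.
have := @minD A (p * (v - x)%:R)
  (discrep R u s q v - discrep R u s q x + 2 * s%:R).
have := @minD A' ((1 - p) * (y - v)%:R)
  (discrep R u s q y - discrep R u s q v + 2 * s%:R).
move=> /(_ ltac:(rewrite /A'; lra) ltac:(lra)) K1.
move=> /(_ ltac:(rewrite /A; lra) ltac:(lra)) K2.
have := natrB R xv; have := natrB R vy.
rewrite /potential E; lra.
Qed.

End Energy.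

Definition square_wave (M K k : nat) : seq bool :=
  flatten (nseq (M ^ (K.+1 - k)) (period (M ^ k.+1))).

Lemma size_square_wave M K k : (0 < M)%N -> (k <= K.+1)%N ->
  size (square_wave M K k) = (2 * M ^ K.+2)%N.
Proof.
move=> M0 kK; rewrite /square_wave size_flatten /shape map_nseq sumn_nseq.
rewrite size_cat !size_nseq addnn -mul2n -mulnA -expnD.
by congr (2 * M ^ _)%N; lia.
Qed.

Section Block.
Variable R : realType.

(** The bound of [lcs_square_wave], with an allowance of [2 * l / M] in place of the discrepancy. *)
Definition wave_good (M K : nat) (u : seq bool) (k : nat) : bool :=
  let l : R := (size u)%:R in
  let b : R := (2 * M ^ K.+2)%:R in
  (lcs u (square_wave M K k))%:R
    <= (l + b) / 3 + 2 * (l + b) / M%:R + 2 * l / M%:R.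

(** The half-period [M ^ k.+1] is [M] times the fine scale and [1 / M] times the coarse one, so both
    the rounding errors and the periods crossing a coarse boundary cost a fraction O(1/M). *)
Lemma lcs_square_wave (M K L k : nat) (u : seq bool) : (0 < M)%N ->
  (k < K)%N -> size u = (L * M ^ K.+1)%N ->
  (lcs u (square_wave M K k))%:R <= ((size u)%:R + (2 * M ^ K.+2)%:R) / 3
    + 2 * ((size u)%:R + (2 * M ^ K.+2)%:R) / M%:R
    + discrep R u (M ^ k) (M ^ 2) (size u).
Proof.
move=> M0 kK uE; have MR : 0 < M%:R :> R by rewrite ltr0n.
have s0 : (0 < M ^ k)%N by rewrite expn_gt0 M0.
have q0 : (0 < M ^ 2)%N by rewrite expn_gt0 M0.
have H := @lcs_slice_nseq R u (period (M ^ k.+1))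
  (potential R u (M ^ k) (M ^ 2) (M ^ k.+1)) _
  (fun x y h => lcs_period R _ s0 q0 h) (M ^ (K.+1 - k)) 0 (size u).
have : potential R u (M ^ k) (M ^ 2) (M ^ k.+1) 0 = 0.
  by rewrite /potential /discrep !div0n big_ord0 mul0r mulr0 !addr0.
move=> P0; rewrite P0 in H.
have := H _ _; rewrite {H} /slice subn0 drop0 take_size leqnn subr0.
set f := discrep _ _ _ _ _; set l : R := (size u)%:R.
have -> : potential R u (M ^ k) (M ^ 2) (M ^ k.+1) (size u) =
    l / 3 + f + 2 * (l / M%:R).
  rewrite /potential -/f -/l; congr (_ + _); rewrite -mulrA; congr (_ * _).
  (* Since [k < K], the coarse block length divides [size u], and the number of coarse blocks is
     exact. *)
  have -> : (size u = L * M ^ (K.-1 - k) * (M ^ k * M ^ 2))%N.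
    by rewrite uE -mulnA -!expnD; congr (_ * M ^ _)%N; lia.
  rewrite mulnK ?muln_gt0 ?expn_gt0 ?M0// /l uE -natrM.
  apply: (mulIf (lt0r_neq0 MR)); rewrite mulfVK ?gt_eqF// -!natrM.
  by congr _%:R; rewrite mulnCA -!mulnA -expnSr -expnD; congr (_ * M ^ _)%N; lia.
move=> /(_ isT) H; apply: le_trans (H _) _.
  have f0 : 0 <= f by exact: discrep_ge0.
  by rewrite !addr_ge0 ?divr_ge0// mulr_ge0// divr_ge0.
have E1 : (M ^ (K.+1 - k))%:R * (M ^ k.+1)%:R = (M ^ K.+2)%:R :> R.
  by rewrite -natrM -expnD; congr (M ^ _)%:R; lia.
have E2 : (M ^ (K.+1 - k))%:R * (M ^ k)%:R = (M ^ K.+2)%:R / M%:R :> R.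
  apply: (mulIf (lt0r_neq0 MR)); rewrite mulfVK ?gt_eqF// -!natrM -expnD -expnSr.
  by congr (M ^ _)%:R; lia.
rewrite -[X in _ + X]mulr_natl mulrDr.
have -> : (M ^ (K.+1 - k))%:R * (2 * (M ^ k.+1)%:R / 3) = 2 * (M ^ K.+2)%:R / 3 :> R.
  by rewrite -E1; field.
have -> : (M ^ (K.+1 - k))%:R * (4 * (M ^ k)%:R) = 4 * ((M ^ K.+2)%:R / M%:R) :> R.
  by rewrite -E2; ring.
rewrite natrM !mulrDr !mulrDl; lra.
Qed.

(** A bad scale has discrepancy above [2 * size u / M]; by [discrep_energy] with [c = M], half of
    this forces an energy drop of [4 * size u / M ^ 2]. The drops add up to at most [2 * size u]. *)
Lemma wave_bad_card (M K L : nat) (u : seq bool) : (0 < M)%N -> (0 < L)%N ->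
  size u = (L * M ^ K.+1)%N ->
  (#|[pred k : 'I_K | ~~ wave_good M K u k]| <= M ^ 2)%N.
Proof.
move=> M0 L0 uE; have MR : 0 < M%:R :> R by rewrite ltr0n.
have q0 : (0 < M ^ 2)%N by rewrite expn_gt0 M0.
have s0 k : (0 < M ^ k)%N by rewrite expn_gt0 M0.
pose e k := energy R u (M ^ k) (L * M ^ (K.+1 - k)).
have eE k : (k < K)%N -> (e k = energy R u (M ^ k) (L * M ^ (K.-1 - k) * M ^ 2))
    * (e k.+2 = energy R u (M ^ k * M ^ 2) (L * M ^ (K.-1 - k))).
  move=> kK; rewrite /e -mulnA -!expnD addn2.
  by split; congr energy; f_equal; try f_equal; lia.
have e0 k : 0 <= e k by exact: energy_ge0.
have el k : (k <= K.+1)%N -> e k <= (size u)%:R.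
  move=> kK; apply: le_trans (energy_le _ _ _ _) _.
  by rewrite ler_nat uE -mulnA -expnD subnK.
have l0 : 0 < (size u)%:R :> R by rewrite ltr0n uE muln_gt0 L0 s0.
have dec k : (k < K)%N -> 0 <= e k - e k.+2.
  move=> kK; rewrite (eE _ kK).1 (eE _ kK).2 energy_variance//.
  apply: sumr_ge0 => j _.
  by rewrite divr_ge0// sqr_ge0.
(* Telescoping: the energies stay between 0 and the length of [u]. *)
have tot : \sum_(k < K) (e k - e k.+2) <= 2 * (size u)%:R.
  have -> : \sum_(k < K) (e k - e k.+2) = e 0%N + e 1%N - e K - e K.+1.
    rewrite -(big_mkord xpredT (fun k => e k - e k.+2)).
    rewrite (eq_bigr (fun k => - (e k.+1 + e k.+2 - (e k + e k.+1)))).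
      by rewrite sumrN (telescope_sumr (fun k => e k + e k.+1))//; ring.
    by move=> k _; ring.
  have := el 0%N isT; have := el 1%N isT; have := e0 K; have := e0 K.+1.
  lra.
have bad (k : 'I_K) : ~~ wave_good M K u k ->
    4 * (size u)%:R / M%:R ^+ 2 <= e k - e k.+2.
  have kK := ltn_ord k; rewrite -ltNge => B.
  have := lcs_square_wave M0 kK uE.
  have := @discrep_energy R u (M ^ k) (M ^ 2) (L * M ^ (K.-1 - k)) M%:R
    (s0 k) q0 MR.
  have -> : (L * M ^ (K.-1 - k) * (M ^ k * M ^ 2) = size u)%N.
    by rewrite uE -mulnA -!expnD; congr (_ * M ^ _)%N; lia.
  rewrite -(eE _ kK).1 -(eE _ kK).2 => H1 H2.
  have H3 : (size u)%:R / M%:R <= M%:R / 4 * (e k - e k.+2) by lra.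
  have {}H3 := ler_wpM2l (ltW (divr_gt0 (ltr0n _ 4) MR)) H3.
  rewrite (_ : 4 / M%:R * (M%:R / 4 * (e k - e k.+2)) = e k - e k.+2) in H3.
    by apply: le_trans H3; rewrite le_eqVlt; apply/orP; left; apply/eqP; field;
      rewrite gt_eqF.
  by field; rewrite gt_eqF.
have : \sum_(k : 'I_K | ~~ wave_good M K u k) (4 * (size u)%:R / M%:R ^+ 2)
    <= 2 * (size u)%:R :> R.
  apply: le_trans tot; rewrite [leRHS](bigID (fun k : 'I_K => ~~ wave_good M K u k)).
  rewrite /=.
  rewrite -[leLHS]addr0; apply: lerD; first exact: ler_sum.
  by apply: sumr_ge0 => k _; exact: dec.
rewrite sumr_const -[leLHS]mulr_natl -(ler_nat R) natrX.
set c : R := #|_|%:R => H.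
rewrite -/c.
have : c * 4 <= 2 * M%:R ^+ 2.
  rewrite -(ler_pM2r l0) (_ : c * 4 * _ =
    c * (4 * (size u)%:R / M%:R ^+ 2) * M%:R ^+ 2).
    by rewrite [leRHS]mulrAC ler_pM2r ?exprn_gt0.
  by field; rewrite gt_eqF.
have : 0 <= c by exact: ler0n.
lra.
Qed.

End Block.

(** * Random concatenations of square waves *)

Local Open Scope nat_scope.

(** [p] lists the cut points of an alignment. [p 0] may be positive: the symbols of [z] before it
    are matched with nothing. *)
Lemma lcs_flatten (z : seq bool) (s : seq (seq bool)) (y : nat) :
  y <= size z ->
  exists p : nat -> nat, [/\ forall i, i < size s -> p i <= p i.+1,
    p (size s) = y &
    lcs (slice 0 y z) (flatten s)
      <= \sum_(i < size s) lcs (slice (p i) (p i.+1) z) (nth [::] s i)].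
Proof.
elim/last_ind: s y => [|s v IH] y yz.
  by exists (fun=> y); split=> //; rewrite (leq_trans (lcs_sizer _ _)).
have [x /andP[_ xy]] := lcs_slice_catr (flatten s) v (leq0n y) yz.
rewrite flatten_rcons => H.
have [p [pm px pH]] := IH x (leq_trans xy yz).
exists (fun i => if i <= size s then p i else y); rewrite size_rcons.
split=> [i||] /=.
- rewrite ltnS => le; case: ltngtP le => // [ls|->] _; last by rewrite px.
  exact: pm.
- by rewrite ltnn.
rewrite big_ord_recr /= leqnn ltnn nth_rcons ltnn eqxx px.
apply: leq_trans H _; rewrite leq_add2r (leq_trans pH)//.
apply: leq_sum => i _.
by rewrite ltn_ord (ltnW (ltn_ord i)) nth_rcons ltn_ord.
Qed.

(** Exponential Markov inequality: with weight [r ^ M] per bad coordinate, each counted [f] weighs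
    at least [r ^ N], while the total weight factors into [N] sums of at most [2 * K]. *)
Lemma count_many_bad (N K M r : nat) (bad : 'I_N -> pred 'I_K) :
  0 < r -> (forall i, #|bad i| * r ^ M <= K) ->
  r ^ N * #|[pred f : {ffun 'I_N -> 'I_K} |
              N < M * #|[pred i | bad i (f i)]|]| <= (2 * K) ^ N.
Proof.
move=> r0 badK; pose w i k := if bad i k then r ^ M else 1.
have -> : (2 * K) ^ N = \prod_(i < N) (2 * K).
  by rewrite prod_nat_const card_ord.
apply: (@leq_trans (\prod_(i < N) \sum_(k < K) w i k)); last first.
  apply: leq_prod => i _; rewrite (bigID (bad i)) /=.
  rewrite (eq_bigr (fun=> r ^ M)); last by move=> k; rewrite /w => ->.
  rewrite [X in _ + X](eq_bigr (fun=> 1)); last first.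
    by move=> k; rewrite /w => /negbTE->.
  rewrite !sum_nat_const muln1 mul2n -addnn leq_add//.
  by rewrite (leq_trans (max_card _))// card_ord.
rewrite bigA_distr_bigA /= mulnC -sum_nat_const.
rewrite big_mkcond; apply: leq_sum => f _; case: ifP => //; rewrite inE => Hf.
rewrite (bigID (fun i => bad i (f i))) /= (eq_bigr (fun=> r ^ M)); last first.
  by move=> i; rewrite /w => ->.
rewrite prod_nat_const -expnM -[leqLHS]muln1 leq_mul//.
  by apply: leq_pexp2l => //; exact: ltnW.
by apply: prodn_cond_gt0 => i /negbTE; rewrite /w => ->.
Qed.

Definition hard_blocks (M K N : nat) (f : {ffun 'I_N -> 'I_K}) : seq bool :=
  flatten [seq square_wave M K (f i) | i <- enum 'I_N].

Section Pieces.
Variable R : realType.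
Variables (M K N Q : nat) (z : seq bool).
Hypothesis M0 : 0 < M.

Local Notation B := (2 * M ^ K.+2).
Local Notation g := (M ^ K.+1).

Definition grid (q : N.+1.-tuple 'I_Q.+1) (i : nat) : nat := nth ord0 q i.

(* The pieces overlap by [M ^ K.+1], so that they contain the parts cut out by
   an alignment whose cut points are rounded down to the grid. *)
Definition piece (q : N.+1.-tuple 'I_Q.+1) (i : nat) : seq bool :=
  slice (grid q i * g) ((grid q i.+1).+1 * g) (z ++ nseq g false).

Definition nbad (q : N.+1.-tuple 'I_Q.+1) (f : {ffun 'I_N -> 'I_K}) : nat :=
  #|[pred i : 'I_N | ~~ wave_good R M K (piece q i) (f i)]|.

Hypothesis QE : Q = size z %/ g.

Lemma grid_sortedP (q : N.+1.-tuple 'I_Q.+1) :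
  reflect (forall i, i < N -> grid q i <= grid q i.+1) (sorted leq (map val q)).
Proof.
apply: (iffP (sortedP 0)) => H i; move: (H i);
  rewrite ?size_map ?size_tuple ?ltnS => {}H iN; move: (H iN);
  by rewrite !(nth_map ord0) ?size_tuple ?ltnS// ltnW.
Qed.

Lemma grid_le (q : N.+1.-tuple 'I_Q.+1) (i : nat) : grid q i * g <= size z.
Proof.
rewrite (leq_trans _ (leq_divM (size z) g))// leq_mul2r -QE -ltnS.
by rewrite /cut ltn_ord orbT.
Qed.

Lemma size_piece (q : N.+1.-tuple 'I_Q.+1) (i : nat) :
  size (piece q i) = ((grid q i.+1).+1 - grid q i) * g.
Proof.
by rewrite size_slice ?mulnBl// size_cat size_nseq mulSn addnC leq_add2r grid_le.
Qed.

Lemma sum_size_piece (q : N.+1.-tuple 'I_Q.+1) : sorted leq (map val q) ->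
  \sum_(i < N) size (piece q i) <= size z + N * g.
Proof.
move=> /grid_sortedP grid_step.
have -> : \sum_(i < N) size (piece q i) =
    (\sum_(i < N) (grid q i.+1 - grid q i) + N) * g.
  rewrite -[X in _ + X]card_ord -sum1_card -big_split /= big_distrl.
  by apply: eq_bigr => i _; rewrite size_piece subSn ?grid_step// addn1.
rewrite mulnDl leq_add2r -(big_mkord xpredT (fun i => grid q i.+1 - grid q i)).
rewrite telescope_sumn_in//.
by apply: leq_trans (grid_le q N); rewrite leq_mul2r leq_subr orbT.
Qed.

Lemma lcs_hard_blocks (f : {ffun 'I_N -> 'I_K}) :
  exists2 q : N.+1.-tuple 'I_Q.+1, sorted leq (map val q) &
  lcs z (hard_blocks M f)
    <= \sum_(i < N) lcs (piece q i) (square_wave M K (f i)).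
Proof.
(* The padding gives the last piece room for its extra grid step; the cut points themselves stay
   within [z]. *)
pose z' := z ++ nseq g false.
have zz' : size z <= size z' by rewrite size_cat leq_addr.
pose s := [seq square_wave M K (f i) | i <- enum 'I_N].
have ss : size s = N by rewrite size_map size_enum_ord.
have g0 : 0 < g by rewrite expn_gt0 M0.
have [p [pm pz pH]] := lcs_flatten s zz'; rewrite ss in pm pz pH.
have pz' i : i <= N -> p i <= size z.
  move=> /subnKC; rewrite -pz; move: (N - i) => d; elim: d i => [|d IH] i.
    by rewrite addn0 => ->.
  rewrite addnS -addSn => E; apply: leq_trans (IH _ E); apply: pm.
  by rewrite -E addSn ltnS leq_addr.
pose q : N.+1.-tuple 'I_Q.+1 := [tuple inord (p i %/ g) | i < N.+1].
have qE i : i <= N -> grid q i = p i %/ g.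
  move=> iN; have -> : grid q i = tnth q (Ordinal (iN : i < N.+1)).
    by rewrite (tnth_nth ord0).
  rewrite tnth_map tnth_ord_tuple inordK//.
  by rewrite ltnS QE leq_div2r// pz'.
exists q.
  apply/grid_sortedP => i iN.
  by rewrite (qE i (ltnW iN)) (qE i.+1 iN) leq_div2r// pm.
rewrite (_ : z = slice 0 (size z) z'); last first.
  by rewrite /slice drop0 subn0 take_size_cat.
apply: leq_trans pH _; apply: leq_sum => i _.
rewrite (nth_map i) ?size_enum_ord// nth_ord_enum; apply: lcs_subseql.
apply: slice_subseq; rewrite qE ?(ltnW (ltn_ord i))//; first exact: leq_divM.
by rewrite ltnW// ltn_ceil.
Qed.

End Pieces.

Section Hard.
Variable R : realType.

(** The pieces of [z] and the waves each have total length at most about [size z], so the thirds add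
    up to 2/3. The overlaps of the pieces and the at most [N / M] bad blocks, charged in full, cost
    O(1/M). *)
Lemma lcs_hard_blocks_le (M K N Q : nat) (z : seq bool)
    (f : {ffun 'I_N -> 'I_K}) : 0 < M -> Q = size z %/ M ^ K.+1 ->
  N * (2 * M ^ K.+2) <= size z ->
  (forall q : (N.+1).-tuple 'I_Q.+1, sorted leq (map val q) ->
    M * nbad R M z q f <= N) ->
  ((lcs z (hard_blocks M f))%:R <= (2 / 3 + 12 / M%:R) * (size z)%:R :> R)%R.
Proof.
move=> M0 QE Nn few; have MR : (0 < M%:R :> R)%R by rewrite ltr0n.
have [q sq] := lcs_hard_blocks M0 QE f; rewrite -(ler_nat R) natr_sum.
move=> /le_trans; apply; have {}few := few q sq.
have B0 : (0 <= (2 * M ^ K.+2)%:R :> R)%R by [].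
pose l i : R := ((size (piece M K z q i))%:R)%R.
set b : R := ((2 * M ^ K.+2)%:R)%R in B0.
pose T i : R := ((l i + b) / 3 + 2 * (l i + b) / M%:R + 2 * l i / M%:R)%R.
pose bad (i : 'I_N) := ~~ wave_good R M K (piece M K z q i) (f i).
have T0 i : (0 <= T i)%R.
  have l0 : (0 <= l i)%R by exact: ler0n.
  by rewrite !addr_ge0 ?divr_ge0 ?mulr_ge0 ?addr_ge0.
have step (i : 'I_N) : ((lcs (piece M K z q i) (square_wave M K (f i)))%:R
    <= T i + b * (bad i)%:R :> R)%R.
  case E: (bad i); rewrite ?mulr1 ?mulr0 ?addr0.
    apply: le_trans (_ : b <= _)%R; last by rewrite lerDr T0.
    rewrite ler_nat (leq_trans (lcs_sizer _ _))// size_square_wave//.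
    by rewrite ltnW// ltnS ltnW.
  by move/negbFE: E.
apply: (@le_trans _ _ (\sum_(i < N) (T i + b * (bad i)%:R))%R).
  exact: ler_sum.
rewrite big_split /= -mulr_sumr.
have -> : (\sum_(i < N) (bad i)%:R = (nbad R M z q f)%:R :> R)%R.
  rewrite -natr_sum; congr (_%:R)%R; rewrite /nbad -sum1_card [RHS]big_mkcond.
  by apply: eq_bigr => i _; rewrite inE /bad; case: ifP.
have lsum : (\sum_(i < N) l i <= (size z)%:R + (N * M ^ K.+1)%:R)%R.
  by rewrite -natr_sum -natrD ler_nat sum_size_piece.
have -> : (\sum_(i < N) T i = (\sum_(i < N) l i + N%:R * b) / 3
    + 2 * (\sum_(i < N) l i + N%:R * b) / M%:R
    + 2 * (\sum_(i < N) l i) / M%:R)%R.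
  rewrite -(sum_ord_const N) -big_split /= !mulr_sumr !mulr_suml -!big_split /=.
  by apply: eq_bigr => i _.
set S := (\sum_(i < N) l i)%R in lsum *.
set n : R := ((size z)%:R)%R in lsum *.
have NB : (N%:R * b <= n)%R by rewrite -natrM ler_nat.
have Ng : ((N * M ^ K.+1)%:R = N%:R * b / M%:R / 2 :> R)%R.
  by rewrite /b (expnS M K.+1) !natrM; field; rewrite gt_eqF.
have M1 : (1 <= M%:R :> R)%R by rewrite ler1n.
have n0 : (0 <= n)%R by exact: ler0n.
set w := (M%:R^-1)%R in Ng *.
have w0 : (0 < w)%R by rewrite invr_gt0.
have w1 : (w <= 1)%R by rewrite invf_le1.
have NBw : (N%:R * b * w <= n * w)%R by rewrite ler_wpM2r// ltW.
have Sle : (S <= n + n * w / 2)%R by rewrite Ng in lsum; lra.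
have nw : (n * w <= n)%R by rewrite ler_piMr.
have bad_le : (b * (nbad R M z q f)%:R <= n * w)%R.
  rewrite ler_pdivlMr// mulrAC -mulrA -natrM mulnC (le_trans _ NB)//.
  by rewrite mulrC ler_wpM2r// ler_nat mulnC.
have Sw : (S * w <= n * w + n * w / 2)%R.
  by have := ler_wpM2r (ltW w0) Sle; nra.
nra.
Qed.

(** Union bound over the monotone grid tuples. For a fixed tuple the pieces do not depend on [f], so
    [wave_bad_card] bounds the bad scales of each coordinate separately. *)
Lemma count_bad_blocks (M K N Q r : nat) (z : seq bool) : 0 < M -> 0 < r ->
  Q = size z %/ M ^ K.+1 -> M ^ 2 * r ^ M <= K ->
  r ^ N * #|[pred f : {ffun 'I_N -> 'I_K} |
      [exists q : (N.+1).-tuple 'I_Q.+1,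
         sorted leq (map val q) && (N < M * nbad R M z q f)]]|
    <= 2 ^ (N.+1 + Q) * (2 * K) ^ N.
Proof.
move=> M0 r0 QE rK.
(* The binomial coefficient is one term in the expansion of [(1 + 1) ^ (N.+1 + Q)]. *)
have le2 : 'C(N.+1 + Q, N.+1) <= 2 ^ (N.+1 + Q).
  rewrite -[2]/(1 + 1) expnDn (bigD1 (inord N.+1)) //= inordK ?ltnS ?leq_addr//.
  by rewrite !exp1n !muln1 leq_addr.
apply: leq_trans (_ : 'C(N.+1 + Q, N.+1) * (2 * K) ^ N <= _); last first.
  by rewrite leq_mul2r le2 orbT.
rewrite -card_sorted_tuples cardsE -sum_nat_const.
apply: leq_trans (_ : \sum_(q in [pred q : (N.+1).-tuple 'I_Q.+1 |
                                 sorted leq (map val q)])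
   r ^ N * #|[pred f : {ffun 'I_N -> 'I_K} | N < M * nbad R M z q f]| <= _).
  rewrite -big_distrr /= leq_mul2l -sum1_card; apply/orP; right.
  under [leqRHS]eq_bigr => q _ do rewrite -sum1_card big_mkcond.
  rewrite exchange_big /= big_mkcond; apply: leq_sum => f _.
  case: ifP => //; rewrite inE => /existsP[q /andP[sq qf]].
  by rewrite (bigD1 q) ?inE//= qf.
apply: leq_sum => q; rewrite inE => /grid_sortedP grid_step.
apply: (@count_many_bad N K M r
  (fun i k => ~~ wave_good R M K (piece M K z q i) k)) => // i.
apply: leq_trans rK; rewrite leq_mul2r; apply/orP; right.
apply: leq_trans (@wave_bad_card R M K ((grid q i.+1).+1 - grid q i) _ M0 _
  (size_piece QE q i)).
  by apply/eq_leq/eq_card => k; rewrite !inE.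
by rewrite subn_gt0 ltnS grid_step.
Qed.

End Hard.

(** * Hard inputs of length n and the union bound over outputs *)

Lemma size_hard_blocks (M K N : nat) (f : {ffun 'I_N -> 'I_K}) : 0 < M ->
  size (hard_blocks M f) = N * (2 * M ^ K.+2).
Proof.
move=> M0; rewrite /hard_blocks size_flatten sumnE /shape 2!big_map big_enum /=.
rewrite (eq_bigr (fun=> 2 * M ^ K.+2)); first by rewrite sum_nat_const card_ord.
by move=> i _; rewrite size_square_wave// ltnW// ltnS ltnW.
Qed.

Lemma hard_string_subproof (M K N n : nat) (f : {ffun 'I_N -> 'I_K}) :
  size (take n (hard_blocks M f ++ nseq n false)) == n.
Proof. by rewrite size_takel// size_cat size_nseq leq_addl. Qed.

(** [take] fixes the length for every [N]; with [N = n %/ block_size M] it keeps all blocks and pads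
    them with fewer than [block_size M] zeros. *)
Definition hard_string (M K N n : nat) (f : {ffun 'I_N -> 'I_K}) : n.-tuple bool :=
  Tuple (hard_string_subproof M n f).

(* [M ^ 2] bounds the number of bad scales in a block; the second factor makes
   their fraction small enough to beat the number of alignments and outputs. *)
Definition nscales (M : nat) : nat := M ^ 2 * (2 ^ (2 * M + 5)) ^ M.

Definition block_size (M : nat) : nat := 2 * M ^ (nscales M).+2.

Section HardString.
Variable R : realType.
Variables (M n : nat).
Hypothesis M0 : 0 < M.
Local Notation K := (nscales M).
Local Notation B := (block_size M).
Local Notation N := (n %/ B).

(** The summand [B] pays for the zero padding of [hard_string]. *)
Definition lcs_threshold : R :=
  ((2 / 3 + 12 / M%:R) * n%:R + B%:R)%R.

Lemma lcs_hard_string (z : n.-tuple bool) (f : {ffun 'I_N -> 'I_K}) :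
  lcs z (hard_string M n f) <= lcs z (hard_blocks M f) + B.
Proof.
have NB : N * B <= n by exact: leq_divM.
have B0 : 0 < B by rewrite muln_gt0 expn_gt0 M0.
rewrite /hard_string /= take_cat size_hard_blocks// ltnNge NB /=.
apply: leq_trans (lcs_cat_sizer _ _ _) _; rewrite leq_add2l.
rewrite size_takel ?size_nseq ?leq_subr//.
by rewrite leq_subLR addnC -mulSn ltnW// ltn_ceil.
Qed.

(** With [r = 2 ^ (2 * M + 5)], the part [2 ^ (2 * M * N)] of [r ^ N] offsets the alignments, as
    [Q <= 2 * M * N.+1]; the factor [2 ^ (5 * N)] is left for the outputs. *)
Lemma count_bad_strings (z : n.-tuple bool) :
  2 ^ (5 * N) * #|[pred f : {ffun 'I_N -> 'I_K} |
       (lcs_threshold < (lcs z (hard_string M n f))%:R)%R]|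
    <= 2 ^ (2 * N + 1 + 2 * M) * K ^ N.
Proof.
set r := 2 ^ (2 * M + 5); set Q := n %/ M ^ K.+1.
have r0 : 0 < r by rewrite expn_gt0.
have zn : size z = n by rewrite size_tuple.
have QE : Q = size z %/ M ^ K.+1 by rewrite zn.
have B0 : 0 < B by rewrite muln_gt0 expn_gt0 M0.
have g0 : 0 < M ^ K.+1 by rewrite expn_gt0 M0.
have := @count_bad_blocks R M K N Q r z M0 r0 QE (leqnn _).
set c := #|_|; set d := #|_| => H.
have cd : d <= c.
  apply/subset_leq_card/fintype.subsetP => f; rewrite !inE => fb.
  apply: contraLR fb; rewrite negb_exists => /forallP few; rewrite -leNgt.
  apply: le_trans (_ : (lcs z (hard_blocks M f) + B)%:R <= _)%R.
    by rewrite ler_nat lcs_hard_string.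
  rewrite natrD /lcs_threshold lerD2r -[in (n%:R)%R]zn.
  apply: lcs_hard_blocks_le QE _ _ => //; first by rewrite zn leq_divM.
  by move=> q sq; have := few q; rewrite sq /= -leqNgt.
have QM : Q <= 2 * M * N.+1.
  rewrite ltnW// ltn_divLR// (leq_trans (ltn_ceil n B0))//.
  rewrite /block_size (expnS M K.+1) leq_eqVlt; apply/orP; left; apply/eqP.
  ring.
have E1 : r ^ N = 2 ^ (5 * N) * 2 ^ (2 * M * N).
  by rewrite -expnM -expnD; congr (2 ^ _); ring.
rewrite -(leq_pmul2l (expn_gt0 2 (2 * M * N))) mulnA -[_ * 2 ^ (5 * N)]mulnC -E1.
apply: leq_trans (_ : r ^ N * c <= _); first by rewrite leq_mul2l cd orbT.
apply: leq_trans H _; rewrite expnMn !mulnA leq_mul2r -!expnD leq_exp2l//.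
apply/orP; right; nia.
Qed.

(** The union over [2 ^ N] outputs uses up part of that gain, and a factor [2 ^ (2 * N)]
    survives. *)
Lemma count_bad_outputs (Z : {set n.-tuple bool}) : #|Z| <= 2 ^ N ->
  2 ^ (2 * N) * #|[pred f : {ffun 'I_N -> 'I_K} | [exists z in Z,
       (lcs_threshold < (lcs z (hard_string M n f))%:R)%R]]|
    <= 2 ^ (2 * M + 1) * K ^ N.
Proof.
move=> ZN; rewrite -(@leq_pmul2l (2 ^ (3 * N))) ?expn_gt0// !mulnA -!expnD.
have -> : 3 * N + 2 * N = 5 * N by ring.
apply: (@leq_trans (2 ^ N * (2 ^ (2 * N + 1 + 2 * M) * K ^ N))); last first.
  by rewrite mulnA -expnD leq_mul2r leq_exp2l//; apply/orP; right; lia.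
apply: (@leq_trans (#|Z| * (2 ^ (2 * N + 1 + 2 * M) * K ^ N))); last first.
  by rewrite leq_mul2r ZN orbT.
rewrite -sum_nat_const.
apply: (@leq_trans (\sum_(z in Z) 2 ^ (5 * N) * #|[pred f : {ffun 'I_N -> 'I_K} |
       (lcs_threshold < (lcs z (hard_string M n f))%:R)%R]|)); last first.
  by apply: leq_sum => z _; exact: count_bad_strings.
rewrite -big_distrr /= leq_mul2l -sum1_card; apply/orP; right.
under [leqRHS]eq_bigr => z _ do rewrite -sum1_card big_mkcond.
rewrite exchange_big /= big_mkcond; apply: leq_sum => f _.
case: ifP => //; rewrite inE => /existsP[z /andP[zZ zf]].
by rewrite (bigD1 z) ?inE//= zf.
Qed.

Lemma sum_lcs_hard (Z : {set n.-tuple bool})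
    (z : {ffun 'I_N -> 'I_K} -> n.-tuple bool) :
  #|Z| <= 2 ^ N -> (forall f, z f \in Z) ->
  (\sum_f (lcs (z f) (hard_string M n f))%:R <=
    (K ^ N)%:R * (lcs_threshold + n%:R * 2 ^+ (2 * M + 1) / 2 ^+ (2 * N)) :> R)%R.
Proof.
move=> ZN zZ; have := count_bad_outputs ZN.
set bad := [pred f : _ | _] => H.
have T0 : (0 <= lcs_threshold)%R.
  by rewrite addr_ge0 ?mulr_ge0 ?addr_ge0 ?divr_ge0 ?ler0n.
apply: le_trans (_ : \sum_f (lcs_threshold + n%:R * (bad f)%:R) <= _)%R.
  apply: ler_sum => f _; case: (boolP (bad f)) => [_|].
    rewrite mulr1 ler_wpDl// ler_nat (leq_trans (lcs_sizel _ _))//.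
    by rewrite size_tuple.
  rewrite mulr0 addr0 /= negb_exists => /forallP/(_ (z f)).
  by rewrite zZ /= -leNgt.
have badE : (\sum_f (bad f)%:R = #|bad|%:R :> R)%R.
  rewrite -natr_sum; congr (_%:R)%R; rewrite -sum1_card [RHS]big_mkcond.
  by apply: eq_bigr => f _; rewrite -[bad f]/(f \in bad); case: (f \in bad).
rewrite big_split -mulr_sumr badE sumr_const card_ffun !card_ord.
rewrite -[X in (X + _ <= _)%R]mulr_natl [leRHS]mulrDr lerD2l.
rewrite mulrA ler_pdivlMr ?exprn_gt0// mulrCA -mulrA ler_wpM2l ?ler0n//.
by rewrite -!natrX -!natrM ler_nat mulnC (mulnC (K ^ N)).
Qed.

End HardString.

(** * The deletion channel *)

Local Open Scope ring_scope.

Lemma mask_ext (m s s' : seq bool) : size s = size s' ->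
  (forall j, nth false m j -> nth false s j = nth false s' j) ->
  mask m s = mask m s'.
Proof.
elim: m s s' => [|b m IH] [|x s] [|x' s'] //= [ss] H.
have -> : mask m s = mask m s' by apply: IH => // j; exact: (H j.+1).
by case: b H => //= H; have /= -> := H 0%N isT.
Qed.

Lemma size_mask_le n (m x : n.-tuple bool) : (size (mask m x) <= n)%N.
Proof. by rewrite -[leqRHS](size_tuple x) size_subseq// mask_subseq. Qed.

Definition trace n (m x : n.-tuple bool) : n.-bseq bool := Bseq (size_mask_le m x).

Definition traces (t n : nat) (ms : {ffun 'I_t -> n.-tuple bool})
    (x : n.-tuple bool) : t.-tuple (n.-bseq bool) :=
  [tuple trace (ms i) x | i < t].

Definition survivors (t n : nat) (ms : {ffun 'I_t -> n.-tuple bool}) :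
  {set 'I_n} := [set j | [exists i, tnth (ms i) j]]%SET.

Definition indicator n (P : {set 'I_n}) : n.-tuple bool := [tuple j \in P | j < n].

Lemma traces_survivors t n (ms : {ffun 'I_t -> n.-tuple bool}) x :
  traces ms x = traces ms (indicator [set j in survivors ms | tnth x j]%SET).
Proof.
set y := indicator _.
have yE i j : tnth (ms i) j -> tnth y j = tnth x j.
  move=> ij; rewrite tnth_mktuple !inE [X in X && _](_ : _ = true)//.
  by apply/existsP; exists i.
move: y yE => y yE.
apply: eq_from_tnth => i; rewrite !tnth_mktuple; apply: val_inj => /=.
apply: mask_ext => [|j]; first by rewrite !size_tuple.
have [jn|nj] := ltnP j n; last by rewrite !nth_default ?size_tuple.
by rewrite -!(tnth_nth false _ (Ordinal jn)) => /yE.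
Qed.

(** For fixed masks the traces are unchanged when the bits of [x] outside the survivors are cleared,
    so there is at most one output per subset of survivors. *)
Lemma card_outputs t n (A : algorithm t n) (ms : {ffun 'I_t -> n.-tuple bool}) :
  exists2 Z : {set n.-tuple bool}, (#|Z| <= 2 ^ #|survivors ms|)%N &
    forall x, A (traces ms x) \in Z.
Proof.
exists [set A (traces ms (indicator P)) | P in powerset (survivors ms)]%SET.
  by rewrite -card_powerset leq_imset_card.
move=> x; apply/imsetP; exists [set j in survivors ms | tnth x j]%SET.
  by rewrite inE; apply/fintype.subsetP => j; rewrite inE => /andP[].
by rewrite -traces_survivors.
Qed.

Section Channel.
Variable R : realType.

Definition mask_weight (delta : R) n (m : n.-tuple bool) : R :=
  \prod_(i < n) (if tnth m i then 1 - delta else delta).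

Lemma sum_tuple_prod n (F : 'I_n -> bool -> R) :
  \sum_(m : n.-tuple bool) \prod_(i < n) F i (tnth m i)
    = \prod_(i < n) (F i true + F i false).
Proof.
transitivity (\prod_(i < n) \sum_(b : bool) F i b); last first.
  by apply: eq_bigr => i _; rewrite big_bool.
rewrite bigA_distr_bigA /=.
rewrite (reindex (fun f : {ffun 'I_n -> bool} => [tuple f i | i < n])) /=.
  by apply: eq_bigr => f _; apply: eq_bigr => i _; rewrite tnth_mktuple.
exists (fun m : n.-tuple bool => [ffun i => tnth m i]) => [f|m] _.
  by apply/ffunP => i; rewrite ffunE tnth_mktuple.
by apply: eq_from_tnth => i; rewrite tnth_mktuple ffunE.
Qed.

Lemma sum_mask_weight (delta : R) n :
  \sum_(m : n.-tuple bool) mask_weight delta m = 1.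
Proof.
rewrite (sum_tuple_prod (fun _ b => if b then 1 - delta else delta)).
by rewrite big1// => i _; rewrite subrK.
Qed.

Lemma mean_mask_bit (delta : R) n (j : 'I_n) :
  \sum_(m : n.-tuple bool) mask_weight delta m * (tnth m j)%:R = 1 - delta.
Proof.
pose F (i : 'I_n) (b : bool) : R :=
  (if b then 1 - delta else delta) * (if i == j then b%:R else 1).
transitivity (\sum_(m : n.-tuple bool) \prod_(i < n) F i (tnth m i)).
  apply: eq_bigr => m _; rewrite big_split /=; congr (_ * _).
  by rewrite (bigD1 j)//= eqxx big1 ?mulr1// => i /negbTE->.
rewrite sum_tuple_prod (bigD1 j)//= /F eqxx mulr1 mulr0 addr0.
by rewrite big1 ?mulr1// => i /negbTE->; rewrite !mulr1 subrK.
Qed.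

Definition masks_weight (delta : R) t n (ms : {ffun 'I_t -> n.-tuple bool}) : R :=
  \prod_(i < t) mask_weight delta (ms i).

Lemma masks_weight_ge0 (delta : R) t n (ms : {ffun 'I_t -> n.-tuple bool}) :
  0 < delta < 1 -> 0 <= masks_weight delta ms.
Proof.
move=> d01; apply: prodr_ge0 => i _; apply: prodr_ge0 => j _.
by case: ifP => _; lra.
Qed.

Lemma sum_masks_weight (delta : R) t n :
  \sum_(ms : {ffun 'I_t -> n.-tuple bool}) masks_weight delta ms = 1.
Proof.
rewrite -(bigA_distr_bigA (fun _ m => mask_weight delta m)) big1// => i _.
exact: sum_mask_weight.
Qed.

Lemma mean_masks_bit (delta : R) t n (i : 'I_t) (j : 'I_n) :
  \sum_(ms : {ffun 'I_t -> n.-tuple bool})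
    masks_weight delta ms * (tnth (ms i) j)%:R = 1 - delta.
Proof.
pose G (k : 'I_t) (m : n.-tuple bool) : R :=
  mask_weight delta m * (if k == i then (tnth m j)%:R else 1).
transitivity (\sum_(ms : {ffun 'I_t -> n.-tuple bool}) \prod_(k < t) G k (ms k)).
  apply: eq_bigr => ms _; rewrite big_split /=; congr (_ * _).
  by rewrite (bigD1 i)//= eqxx big1 ?mulr1// => k /negbTE->.
rewrite -bigA_distr_bigA (bigD1 i)//= /G eqxx mean_mask_bit.
rewrite big1 ?mulr1// => k /negbTE->.
by under eq_bigr do rewrite mulr1; exact: sum_mask_weight.
Qed.

(** Markov's inequality, the mean number of survivors being at most the mean number of surviving
    bits over all traces. *)
Lemma many_survivors (delta : R) t n (N : nat) : 0 < delta < 1 ->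
  \sum_(ms : {ffun 'I_t -> n.-tuple bool})
    masks_weight delta ms * (N < #|survivors ms|)%N%:R
  <= t%:R * n%:R * (1 - delta) / N.+1%:R.
Proof.
move=> d01; rewrite ler_pdivlMr ?ltr0Sn// mulr_suml.
have -> : t%:R * n%:R * (1 - delta) = \sum_(ms : {ffun 'I_t -> n.-tuple bool})
    \sum_(i < t) \sum_(j < n) masks_weight delta ms * (tnth (ms i) j)%:R.
  rewrite exchange_big /= -mulrA -(sum_ord_const t); apply: eq_bigr => i _.
  rewrite exchange_big /= -(sum_ord_const n); apply: eq_bigr => j _.
  by rewrite mean_masks_bit.
apply: ler_sum => ms _; under eq_bigr do rewrite -mulr_sumr.
rewrite -mulr_sumr -mulrA ler_wpM2l ?masks_weight_ge0//.
apply: le_trans (_ : #|survivors ms|%:R <= _).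
  by case: ltnP => h; rewrite ?mul1r ?mul0r// ler_nat.
rewrite exchange_big /= -sum1_card natr_sum big_mkcond /=.
apply: ler_sum => j _; case: ifP => [|_]; last exact: sumr_ge0.
rewrite inE => /existsP[i ij].
by rewrite (bigD1 i)//= ij lerDl sumr_ge0.
Qed.

(** Moving the randomness from the traces to the masks makes it independent of [x]: masks can be
    fixed first and the input averaged afterwards. *)
Lemma expected_lcs_masks t n (delta : R) (A : algorithm t n) x :
  expected_lcs delta A x = \sum_(ms : {ffun 'I_t -> n.-tuple bool})
    masks_weight delta ms * (lcs (A (traces ms x)) x)%:R.
Proof.
transitivity (\sum_(ys : t.-tuple (n.-bseq bool))
  \sum_(ms : {ffun 'I_t -> n.-tuple bool})
    (\prod_(i < t) if trace (ms i) x == tnth ys i then mask_weight delta (ms i)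
       else 0) * (lcs (A ys) x)%:R).
  apply: eq_bigr => ys _; rewrite -mulr_suml; congr (_ * _).
  rewrite -(bigA_distr_bigA (fun i m =>
    if trace m x == tnth ys i then mask_weight delta m else 0)).
  by apply: eq_bigr => i _; rewrite /Del big_mkcond.
rewrite exchange_big; apply: eq_bigr => ms _.
rewrite (bigD1 (traces ms x))//= [X in _ + X]big1 ?addr0.
  by congr (_ * _); apply: eq_bigr => i _; rewrite tnth_mktuple eqxx.
move=> ys ne; have [i ni] : exists i, trace (ms i) x != tnth ys i.
  apply/existsP; rewrite -negb_forall; apply: contra ne => /forallP H.
  by apply/eqP/eq_from_tnth => i; rewrite tnth_mktuple; apply/esym/eqP.
by rewrite (bigD1 i)//= (negbTE ni) !mul0r.
Qed.

End Channel.

(** * Averaging over hard inputs, and the limit in n *)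

Local Open Scope classical_set_scope.
Local Open Scope ring_scope.

(** The worst input is no better than the average hard one. Masks with at most [N] survivors allow
    at most [2 ^ N] outputs, so [sum_lcs_hard] applies; the others get the trivial bound [n]. *)
Lemma Lworst_le (R : realType) (t M n : nat) (delta : R) : (0 < M)%N ->
  0 < delta < 1 ->
  Lworst t delta n <= lcs_threshold R M n
    + n%:R * 2 ^+ (2 * M + 1) / 2 ^+ (2 * (n %/ block_size M))
    + n%:R * (t%:R * n%:R * (1 - delta) / (n %/ block_size M).+1%:R).
Proof.
move=> M0 d01; set N := (n %/ block_size M)%N; set K := nscales M.
set V := _ + n%:R * _ / _; set p := _ / N.+1%:R.
have V0 : 0 <= V.
  by rewrite !addr_ge0 ?divr_ge0 ?mulr_ge0 ?addr_ge0 ?divr_ge0 ?exprn_ge0.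
have p0 : 0 <= p by rewrite divr_ge0// !mulr_ge0// subr_ge0; lra.
have K0 : 0 < (K ^ N)%:R :> R.
  by rewrite ltr0n !(expn_gt0, muln_gt0) M0.
(* The default value 0 of the maximum must also lie below the bound. *)
rewrite /Lworst; apply: bigmax_le => [|A _].
  by rewrite addr_ge0// mulr_ge0.
set m := \big[_/_]_(_ : _) _.
rewrite -(ler_pM2l K0).
apply: (@le_trans _ _ (\sum_(f : {ffun 'I_N -> 'I_K})
    expected_lcs delta A (hard_string M n f))).
  have -> : (K ^ N)%:R * m = \sum_(f : {ffun 'I_N -> 'I_K}) m.
    by rewrite sumr_const card_ffun !card_ord mulr_natl.
  apply: ler_sum => f _.
  by apply: bigmin_le_cond.
under eq_bigr do rewrite expected_lcs_masks.
rewrite exchange_big /=.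
apply: (@le_trans _ _ (\sum_(ms : {ffun 'I_t -> n.-tuple bool})
   masks_weight delta ms * ((K ^ N)%:R *
     (V + n%:R * (N < #|survivors ms|)%N%:R)))).
  apply: ler_sum => ms _; rewrite -mulr_sumr ler_wpM2l ?masks_weight_ge0//.
  case: ltnP => few.
    apply: (@le_trans _ _ (\sum_(f : {ffun 'I_N -> 'I_K}) n%:R)).
      apply: ler_sum => f _; rewrite ler_nat (leq_trans (lcs_sizel _ _))//.
      by rewrite size_tuple.
    rewrite sumr_const card_ffun !card_ord -[leLHS]mulr_natl ler_pM2l//.
    by rewrite mulr1 lerDr.
  have [Z cZ AZ] := card_outputs A ms.
  rewrite mulr0 addr0; apply: (sum_lcs_hard R M0 (Z := Z)) => //.
  by rewrite (leq_trans cZ)// leq_exp2l.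
rewrite (eq_bigr (fun ms => (K ^ N)%:R * (V * masks_weight delta ms
   + n%:R * (masks_weight delta ms * (N < #|survivors ms|)%N%:R)))); last first.
  by move=> ms _; ring.
rewrite -mulr_sumr big_split /= -!mulr_sumr sum_masks_weight mulr1.
by rewrite ler_pM2l// lerD2l ler_wpM2l// many_survivors.
Qed.

Lemma Lworst_near (R : realType) (kappa : R) (t : nat -> nat)
    (delta : nat -> R) (e : R) :
  0 < kappa -> (forall n : nat, (0 < n)%N -> 0 < delta n < 1) ->
  (forall n : nat, (0 < n)%N -> (t n)%:R * (1 - delta n) <= 1 / n%:R `^ kappa) ->
  0 < e -> \forall n \near \oo, Lworst (t n) (delta n) n <= (2 / 3 + e) * n%:R.
Proof.
move=> k0 d01 tr e0.
(* Four error terms will each get [e / 4]; this choice of [M] settles the first, and the block size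
   is constant from here on. *)
have [M M0 Me] : exists2 M, (0 < M)%N & 12 / M%:R <= e / 4 :> R.
  exists (Num.trunc (48 / e)).+1 => //.
  rewrite ler_pdivrMr ?ltr0Sn//.
  have /ltW := truncnS_gt (48 / e); rewrite ler_pdivrMr// => h.
  by rewrite mulrAC ler_pdivlMr// mulrC; lra.
set B := block_size M.
have B0 : (0 < B)%N by rewrite muln_gt0 expn_gt0 M0.
have BR : 0 < B%:R :> R by rewrite ltr0n.
near=> n.
have n0 : (0 < n)%N by near: n; exact: nbhs_infty_gt.
have nR : 0 < n%:R :> R by rewrite ltr0n.
apply: le_trans (Lworst_le _ _ M0 (d01 n n0)) _; rewrite -/B.
set N := (n %/ B)%N.
have h1 : B%:R <= e / 4 * n%:R.
  have : 4 * B%:R / e <= n%:R by near: n; exact: nbhs_infty_ger.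
  by rewrite ler_pdivrMr//; lra.
have nN : n%:R <= N.+1%:R * B%:R :> R.
  by rewrite -natrM ler_nat ltnW// ltn_ceil.
(* The crude bound [N.+1 <= 2 ^ (2 * N)] is enough, since [N.+1] is at least [n / B]. *)
have h2 : 2 ^+ (2 * M + 1) / 2 ^+ (2 * N) <= e / 4 :> R.
  rewrite ler_pdivrMr ?exprn_gt0// -ler_pdivrMl; last by rewrite divr_gt0.
  apply: (@le_trans _ _ N.+1%:R); last first.
    rewrite -natrX ler_nat; apply: leq_trans (ltn_expl N (isT : 1 < 2)%N) _.
    by rewrite leq_exp2l// leq_pmull.
  rewrite -(ler_pM2r BR) (le_trans _ nN)//.
  near: n; exact: nbhs_infty_ger.
have h3 : (t n)%:R * (1 - delta n) * B%:R <= e / 4.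
  rewrite -ler_pdivlMr//; apply: le_trans (tr n n0) _.
  rewrite div1r -[leRHS]invrK lef_pV2 ?posrE ?powR_gt0 ?invr_gt0 ?divr_gt0//.
  set c := (_^-1); have c0 : 0 < c by rewrite invr_gt0 !divr_gt0.
  (* Here [c] is [4 * B / e]; once [n] reaches its [kappa]-th root, the power of [n] exceeds this
     constant. *)
  have -> : c = (c `^ kappa^-1) `^ kappa.
    by rewrite -powRrM mulVf ?gt_eqF// powRr1// ltW.
  apply: ge0_ler_powR; rewrite ?nnegrE ?powR_ge0//; first exact: ltW.
  near: n; exact: nbhs_infty_ger.
have h4 : (t n)%:R * n%:R * (1 - delta n) / N.+1%:R <= e / 4.
  rewrite ler_pdivrMr ?ltr0Sn//.
  have tr0 : 0 <= (t n)%:R * (1 - delta n).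
    by rewrite mulr_ge0// subr_ge0; have := d01 n n0; lra.
  rewrite mulrAC; apply: le_trans (ler_wpM2l tr0 nN) _.
  by rewrite (mulrC N.+1%:R) mulrA ler_wpM2r.
rewrite /lcs_threshold -/B -[n%:R * _ / _]mulrA.
move: Me h2 h4; set a := 12 / _; set b := 2 ^+ _ / _; set c := _ / N.+1%:R.
clearbody a b c => ale ble cle; nra.
Unshelve. all: by end_near. Qed.

Theorem theorem3p9 (R : realType) (kappa : R) (t : nat -> nat)
    (delta rho : nat -> R)
    (kappa_gt0 : 0 < kappa)
    (t_gt0 : forall n : nat, (0 < n)%N -> (0 < t n)%N)
    (delta_bounds : forall n : nat, (0 < n)%N -> 0 < delta n < 1)
    (rhoE : forall n : nat, (0 < n)%N -> rho n = 1 - delta n)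
    (t_rho_le : forall n : nat, (0 < n)%N ->
      (t n)%:R * rho n <= 1 / n%:R `^ kappa) :
  exists2 o : nat -> R, o n @[n --> \oo] --> (0 : R) &
    \forall n \near \oo, Lworst (t n) (delta n) n <= (2 / 3 + o n) * n%:R.
Proof.
(* The excess over 2/3, clipped at 0 because [Lworst_near] bounds it only from above. *)
pose o n := Num.max 0 (Lworst (t n) (delta n) n / n%:R - 2 / 3).
have tr n : (0 < n)%N -> (t n)%:R * (1 - delta n) <= 1 / n%:R `^ kappa.
  by move=> n0; rewrite -rhoE// t_rho_le.
exists o.
  apply/cvgrPdist_le => e e0; near=> n.
  have nR : 0 < n%:R :> R by rewrite ltr0n; near: n; exact: nbhs_infty_gt.
  rewrite sub0r normrN ger0_norm ?le_max ?lexx// ge_max ltW//=.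
  rewrite lerBlDl ler_pdivrMr//.
  near: n; exact: (Lworst_near kappa_gt0).
near=> n.
have nR : 0 < n%:R :> R by rewrite ltr0n; near: n; exact: nbhs_infty_gt.
rewrite -ler_pdivrMr// -lerBlDl /o le_max lexx orbT.
by [].
Unshelve. all: by end_near. Qed.
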